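(* Let $X$ be a finite set with $|X|\ge 2$, let $\mathbb{M}_X$ be the free monoid with basis $X$, and let $\mathbb{N}=\langle N;+,\cdot,0,1\rangle$ be the standard arithmetic. Then $\mathbb{M}_X$ and $\mathbb{N}$ are bi-interpretable with parameters $X$, uniformly in $X$.
   Context: A subset of $B^n$ is definable in a structure $\mathbb{B}$ with underlying set $B$ (with parameters $P\subseteq B$) if it is the solution set of a first-order formula in the language of $\mathbb{B}$ (possibly using parameters from $P$). A structure $\mathbb{A}$ is interpretable in $\mathbb{B}$ (with parameters $P$) if there are a definable set $A^*\subseteq B^n$ for some $n$, a definable equivalence relation $\sim$ on $A^*$, and definable operations, predicates and constants on $A^*/{\sim}$ such that the resulting structure $\mathbb{A}^*$ is isomorphic to $\mathbb{A}$. Bi-interpretability: $\mathbb{A}$ and $\mathbb{B}$ are bi-interpretable if $\mathbb{B}$ is interpretable in $\mathbb{A}$ as $\mathbb{B}^*$ and $\mathbb{A}$ is interpretable in $\mathbb{B}$ as $\mathbb{A}^*$ (so that, by composing, $\mathbb{A}$ is interpreted in $\mathbb{A}$ as $\mathbb{A}^{**}$ and $\mathbb{B}$ in $\mathbb{B}$ as $\mathbb{B}^{**}$), and there are an isomorphism $\mathbb{A}\to\mathbb{A}^{**}$ definable in $\mathbb{A}$ and an isomorphism $\mathbb{B}\to\mathbb{B}^{**}$ definable in $\mathbb{B}$. ''With parameters $X$'' means that the formulas over $\mathbb{M}_X$ may use elements of $X$ as parameters. ''Uniformly in $X$'' means that the elements of $X$ enter the formulas only as a tuple of parameters, and the same formulas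 work for any choice (enumeration) of the basis $X$. *)

(* Defs.v *)
From mathcomp Require Import all_boot.

Set Implicit Arguments.
Unset Strict Implicit.
Unset Printing Implicit Defensive.

Record language := Language {
  fsym : Type;
  far  : fsym -> nat;
  rsym : Type;
  rar  : rsym -> nat
}.

Record structure (L : language) (T : Type) := Structure {
  fun_of : forall f : fsym L, ('I_(far f) -> T) -> T;
  rel_of : forall r : rsym L, ('I_(rar r) -> T) -> Prop
}.

Inductive term (L : language) (V : Type) : Type :=
| Var (v : V)
| App (f : fsym L) (t : 'I_(far f) -> term L V).

(* The free variables of a formula range over the type V. A quantifier binds
   the variable None of its body; Some v is the outer variable v. *)
Inductive formula (L : language) (V : Type) : Type :=
| Eq (t u : term L V)
| Rel (r : rsym L) (t : 'I_(rar r) -> term L V)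
| Bot
| Imp (F G : formula L V)
| And (F G : formula L V)
| Or (F G : formula L V)
| All (F : formula L (option V))
| Ex (F : formula L (option V)).

Fixpoint eval L T (M : structure L T) V (v : V -> T) (t : term L V) : T :=
  match t with
  | Var x => v x
  | App f t => fun_of M (fun i => eval M v (t i))
  end.

Fixpoint sat L T (M : structure L T) V (v : V -> T) (F : formula L V) : Prop :=
  match F with
  | Eq t u => eval M v t = eval M v u
  | Rel r t => rel_of M (fun i => eval M v (t i))
  | Bot => False
  | Imp F G => sat M v F -> sat M v G
  | And F G => sat M v F /\ sat M v G
  | Or F G => sat M v F \/ sat M v G
  | All F => forall a, sat M (oapp v a) F
  | Ex F => exists a, sat M (oapp v a) F
  end.

Definition join (U V T : Type) (u : U -> T) (v : V -> T) (x : U + V) : T :=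
  match x with inl y => u y | inr z => v z end.

(* The formula F, with the tuple p substituted for its parameter variables P,
   defines the subset S of T^V; V is the (finite) index set of the tuples. *)
Definition defines L T (M : structure L T) P (p : P -> T) V
    (F : formula L (P + V)) (S : (V -> T) -> Prop) : Prop :=
  forall v : V -> T, sat M (join p v) F <-> S v.

Definition isomorphism L T U (M : structure L T) (N : structure L U)
    (h : T -> U) : Prop :=
  [/\ bijective h,
      forall (f : fsym L) x, h (fun_of M (f := f) x) = fun_of N (fun i => h (x i))
    & forall (r : rsym L) x, rel_of M (r := r) x <-> rel_of N (fun i => h (x i))].

(* The formulas of an interpretation of LA-structures in LB-structures, with
   parameter variables P. Elements are represented by dim-tuples; in ops f,
   the tuple None is the value and the tuples Some i are the arguments. *)
Record interpretation (LA LB : language) (P : Type) := Interpretation {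
  dim : nat;
  dom : formula LB (P + 'I_dim);
  eqv : formula LB (P + ('I_dim + 'I_dim));
  ops : forall f : fsym LA, formula LB (P + option 'I_(far f) * 'I_dim);
  preds : forall r : rsym LA, formula LB (P + 'I_(rar r) * 'I_dim)
}.

Definition in_dom LA LB P (I : interpretation LA LB P)
    T (B : structure LB T) (p : P -> T) (a : 'I_(dim I) -> T) : Prop :=
  sat B (join p a) (dom I).

Definition in_eqv LA LB P (I : interpretation LA LB P)
    T (B : structure LB T) (p : P -> T) (a b : 'I_(dim I) -> T) : Prop :=
  sat B (join p (join a b)) (eqv I).

Definition equivalence_on T (D : T -> Prop) (E : T -> T -> Prop) : Prop :=
  [/\ forall a b, E a b -> D a /\ D b,
      forall a, D a -> E a a,
      forall a b, E a b -> E b a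
    & forall a b c, E a b -> E b c -> E a c].

(* The set of equivalence classes: each element is a class, as a predicate on
   tuples. *)
Definition quotient LA LB P (I : interpretation LA LB P)
    T (B : structure LB T) (p : P -> T) : Type :=
  {C : ('I_(dim I) -> T) -> Prop |
    exists2 a, in_dom B p a & C = in_eqv B p a}.

(* A is the structure that I defines in B with the parameters p: the preimage
   of (the graph of) each operation and predicate of A under the projection
   onto the classes is defined by the corresponding formula. Such an A is
   unique. *)
Definition interprets LA LB P (I : interpretation LA LB P)
    T (B : structure LB T) (p : P -> T)
    (A : structure LA (quotient I B p)) : Prop :=
  [/\ equivalence_on (@in_dom _ _ _ I _ B p) (@in_eqv _ _ _ I _ B p),
      forall f : fsym LA,
        defines B p (ops I f) (fun x =>
          exists2 c : 'I_(far f) -> quotient I B p,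
            forall i, sval (c i) (fun j => x (Some i, j))
            & sval (fun_of A c) (fun j => x (None, j)))
    & forall r : rsym LA,
        defines B p (preds I r) (fun x =>
          exists2 c : 'I_(rar r) -> quotient I B p,
            forall i, sval (c i) (fun j => x (i, j))
            & rel_of A c)].

(* B1 is the structure that J defines in A, and A2 the one that I defines in
   B1. The elements of A2 are classes of tuples of elements of B1, which are
   classes of tuples of elements of A; so a point of A2 is represented by a
   (dim I * dim J)-tuple x over A, whose i-th block represents the i-th
   coordinate c i. The formula F defines in A the graph of an isomorphism
   h : A -> A2, pulled back to these representatives (None is the argument). *)
Definition definable_iso LA LB P Q
    (I : interpretation LA LB Q) (J : interpretation LB LA P)
    T (A : structure LA T) (p : P -> T)
    (B1 : structure LB (quotient J A p)) (q1 : Q -> quotient J A p)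
    (F : formula LA (P + option ('I_(dim I) * 'I_(dim J)))) : Prop :=
  exists (A2 : structure LA (quotient I B1 q1)) (h : T -> quotient I B1 q1),
    [/\ interprets A2,
        isomorphism A A2 h
      & defines A p F (fun x =>
          exists2 c : 'I_(dim I) -> quotient J A p,
            forall i, sval (c i) (fun j => x (Some (i, j)))
            & sval (h (x None)) c)].

(* The formulas I, J, F, G witness the bi-interpretability of A with
   parameters p and B with parameters q. When I is applied to the copy B1 of B
   in A, its parameters are the elements of B1 corresponding to q; likewise
   for J. *)
Definition biinterpretation LA LB P Q
    (I : interpretation LA LB Q) (J : interpretation LB LA P)
    (F : formula LA (P + option ('I_(dim I) * 'I_(dim J))))
    (G : formula LB (Q + option ('I_(dim J) * 'I_(dim I))))
    T (A : structure LA T) (p : P -> T)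
    U (B : structure LB U) (q : Q -> U) : Prop :=
  exists (A1 : structure LA (quotient I B q)) (alpha : T -> quotient I B q)
         (B1 : structure LB (quotient J A p)) (beta : U -> quotient J A p),
    [/\ interprets A1 /\ isomorphism A A1 alpha,
        interprets B1 /\ isomorphism B B1 beta,
        definable_iso B1 (beta \o q) F
      & definable_iso A1 (alpha \o p) G].

Variant monoid_sym := MonMul | MonOne.

Definition monoid_language : language :=
  @Language monoid_sym (fun f => if f is MonMul then 2 else 0)
            void (fun=> 0).

Definition free_monoid (X : Type) : structure monoid_language (seq X) :=
  @Structure monoid_language (seq X)
    (fun f => match f return ('I_(@far monoid_language f) -> seq X) -> seq X with
              | MonMul => fun x => x (@Ordinal 2 0 isT) ++ x (@Ordinal 2 1 isT)
              | MonOne => fun=> [::]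
              end)
    (fun=> fun=> False).

Variant arith_sym := ArAdd | ArMul | ArZero | ArOne.

Definition arith_language : language :=
  @Language arith_sym (fun f => match f with ArAdd | ArMul => 2 | _ => 0 end)
            void (fun=> 0).

Definition standard_arithmetic : structure arith_language nat :=
  @Structure arith_language nat
    (fun f => match f return ('I_(@far arith_language f) -> nat) -> nat with
              | ArAdd => fun x => x (@Ordinal 2 0 isT) + x (@Ordinal 2 1 isT)
              | ArMul => fun x => x (@Ordinal 2 0 isT) * x (@Ordinal 2 1 isT)
              | ArZero => fun=> 0
              | ArOne => fun=> 1
              end)
    (fun=> fun=> False).

(* Main.v *)
(* Words are coded in arithmetic by matrices. The monoid SL_2(N) is free on
   A = [[1,1],[0,1]] and B = [[1,0],[1,1]], and the words A^i B with i < n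
   freely generate the submonoid of those matrices that are the identity or end
   in B, and have no factor A^n; concatenation becomes the product of matrices,
   so neither exponentiation nor sequence coding is needed in N.

   Conversely the number k is coded by the power x_0^k of a letter; these
   powers are the words commuting with x_0. Multiplication, and the graph of
   the isomorphism sending a word to the four powers of x_0 given by its matrix,
   are defined by recursions that lengthen one of their arguments. They are
   definable because finite sets of tuples of words can be coded by words, with
   delimiters x_1 x_0^m x_1 for large m. In the other direction the matrix of
   x_0^k is B^k = [[1,0],[k,1]]. *)
Require Import Defs.
From mathcomp Require Import all_boot.
From mathcomp Require Import boolp zify.

Set Implicit Arguments.
Unset Strict Implicit.
Unset Printing Implicit Defensive.

(** * Interpretations with unique representatives *)

Section Transport.

Variables (L : language) (T U : Type).
Variables (M : structure L T) (N : structure L U) (h : T -> U).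
Hypothesis isoh : isomorphism M N h.

Lemma eval_iso V (v : V -> T) t : eval N (h \o v) t = h (eval M v t).
Proof.
case: isoh => _ hf _; elim: t => [x|f t IH] //=.
by rewrite hf; congr (fun_of N _); apply: funext.
Qed.

(** Injectivity of [h] settles the equality atoms; its inverse supplies preimages for the
    quantifiers. *)
Lemma sat_iso V (v : V -> T) F : sat N (h \o v) F <-> sat M v F.
Proof.
have [[g hK gK] _ hr] := isoh.
have E W (w : W -> T) a : oapp (h \o w) (h a) = h \o oapp w a.
  by apply: funext => -[].
elim: F v => {V} /=.
- move=> V t u v; rewrite !eval_iso; split=> [/(can_inj hK)//|->//].
- move=> V r t v; rewrite hr.
  by under eq_fun do rewrite eval_iso.
- by [].
- by move=> V F IHF G IHG v; rewrite IHF IHG.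
- by move=> V F IHF G IHG v; rewrite IHF IHG.
- by move=> V F IHF G IHG v; rewrite IHF IHG.
- move=> V F IH v; split=> H a; first by rewrite -IH -E.
  by rewrite -(gK a) E IH.
- move=> V F IH v; split=> -[a Ha]; last by exists (h a); rewrite E IH.
  by exists (g a); rewrite -IH -E gK.
Qed.

Lemma defines_iso P (p : P -> T) V (F : formula L (P + V)) S S' :
  defines M p F S -> (forall v, S' (h \o v) <-> S v) ->
  defines N (h \o p) F S'.
Proof.
have [[g hK gK] _ _] := isoh.
move=> MF SS' v.
have -> : v = h \o (g \o v) by apply: funext => x /=; rewrite gK.
rewrite SS' -MF -sat_iso.
suff -> : join (h \o p) (h \o (g \o v)) = h \o join p (g \o v) by [].
by apply: funext => -[].
Qed.

Lemma isomorphism_inv (g : U -> T) : cancel h g -> cancel g h ->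
  isomorphism N M g.
Proof.
move=> hK gK; have [_ hf hr] := isoh.
have E W (w : W -> U) : w = (fun i => h (g (w i))).
  by apply: funext => i; rewrite gK.
split; first by exists h.
- by move=> f x; rewrite {1}(E _ x) -hf hK.
- by move=> r x; rewrite {1}(E _ x) -hr.
Qed.

End Transport.

(* [I] interprets [A] in [B] with every element [u] of [A] having exactly one
   representative, the tuple [r u]. *)
Record codes LA LB P (I : interpretation LA LB P) T (B : structure LB T)
    (p : P -> T) U (A : structure LA U) (r : U -> 'I_(dim I) -> T) : Prop :=
  Codes {
  codes_inj : injective r;
  codes_dom : defines B p (dom I) (fun a => exists u, a = r u);
  codes_eqv : defines B p (eqv I) (fun x =>
    exists u, x \o inl = r u /\ x \o inr = r u);
  codes_ops : forall f, defines B p (ops I f) (fun x => exists c,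
    (forall i, (fun j => x (Some i, j)) = r (c i)) /\
    (fun j => x (None, j)) = r (fun_of A (f := f) c));
  codes_preds : forall s, defines B p (preds I s) (fun x => exists c,
    (forall i, (fun j => x (i, j)) = r (c i)) /\ rel_of A (r := s) c)
}.

Arguments codes {LA LB P} I {T} B p {U} A r.

Lemma comp_inj T U V (h : T -> U) : injective h ->
  forall x y : V -> T, h \o x = h \o y <-> x = y.
Proof.
move=> hI x y; split=> [E|->//]; apply: funext => i; apply: hI.
exact: (congr1 (@^~ i) E).
Qed.

(** The formulas of [I] stay fixed while representatives and parameters move along [h]. This serves
    both to change the basis of the free monoid and to apply an interpretation inside an interpreted
    copy. *)
Lemma codes_iso_target LA LB P (I : interpretation LA LB P) T
    (B : structure LB T) (p : P -> T) U (A : structure LA U) r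
    T' (B' : structure LB T') h :
  codes I B p A r -> isomorphism B B' h ->
  codes I B' (h \o p) A (fun u => h \o r u).
Proof.
move=> [rI rd re ro rp] iso.
have hI : injective h by have [/bij_inj] := iso.
have hE := comp_inj hI.
split.
- by move=> u v /hE /rI.
- apply: (defines_iso iso rd) => v.
  by split=> -[u /hE]; exists u => //; apply/hE.
- apply: (defines_iso iso re) => v.
  by split=> -[u [/hE H1 /hE H2]]; exists u; split => //; apply/hE.
- move=> f; apply: (defines_iso iso (ro f)) => v.
  by split=> -[c [H1 /hE H2]]; exists c; split => // i; apply/hE/H1.
- move=> s; apply: (defines_iso iso (rp s)) => v.
  by split=> -[c [H1 H2]]; exists c; split => // i; apply/hE/H1.
Qed.

Lemma codes_iso_source LA LB P (I : interpretation LA LB P) T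
    (B : structure LB T) (p : P -> T) U (A : structure LA U) r
    U' (A' : structure LA U') g :
  codes I B p A r -> isomorphism A' A g -> codes I B p A' (r \o g).
Proof.
move=> [rI rd re ro rp] [[h gK hK] gf gr].
split.
- by move=> u v /rI /(can_inj gK).
- move=> v; rewrite rd; split=> -[u ->]; last by exists (g u).
  by exists (h u); rewrite /= hK.
- move=> v; rewrite re; split=> -[u H]; last by exists (g u).
  by exists (h u); rewrite /= hK.
- move=> f v; rewrite ro; split=> -[c [H1 H2]].
    exists (h \o c); split=> [i|]; rewrite /= ?hK //.
    by rewrite gf H2; congr (r (fun_of A _)); apply: funext => i /=; rewrite hK.
  by exists (g \o c); rewrite -gf.
- move=> s v; rewrite rp; split=> -[c [H1 H2]].
    exists (h \o c); split=> [i|]; rewrite /= ?hK //.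
    by rewrite gr; congr (rel_of A _): H2; apply: funext => i /=; rewrite hK.
  by exists (g \o c); rewrite -gr.
Qed.

(** Representatives being unique, every class is a singleton: [alpha u] is the class of [r u], and
    the quotient receives the structure of [A] along [alpha]. *)
Lemma codes_interprets LA LB P (I : interpretation LA LB P) T
    (B : structure LB T) (p : P -> T) U (A : structure LA U) r :
  codes I B p A r ->
  exists (A1 : structure LA (quotient I B p)) (alpha : U -> quotient I B p),
    [/\ interprets A1, isomorphism A A1 alpha
      & forall u a, sval (alpha u) a <-> a = r u].
Proof.
move=> [rI rd re ro rp].
have eqvE a b : in_eqv B p a b <-> exists2 u, a = r u & b = r u.
  by rewrite /in_eqv re; split=> [[u [ha hb]]|[u ha hb]]; exists u.
have domP u : exists2 a, in_dom B p a & in_eqv B p (r u) = in_eqv B p a.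
  by exists (r u) => //; apply/rd; exists u.
pose alpha u : quotient I B p := exist _ _ (domP u).
have alphaE u a : sval (alpha u) a <-> a = r u.
  rewrite /= eqvE; split=> [[w /rI -> ->]//|->]; by exists u.
have quotient_inj (C D : quotient I B p) : sval C = sval D -> C = D.
  by case: C D => [C hC] [D hD] /= E; subst D; congr exist; apply: Prop_irrelevance.
have surj C : {u | alpha u = C}.
  apply: cid; case: (svalP C) => a /rd [u au] E; exists u.
  by apply: quotient_inj; rewrite E au.
pose g C := sval (surj C).
have gK : cancel g alpha by move=> C; apply: (svalP (surj C)).
have alphaK : cancel alpha g.
  move=> u; apply: rI; apply/esym/alphaE; rewrite gK; exact/alphaE.
pose A1 := @Structure LA (quotient I B p)
  (fun f c => alpha (fun_of A (g \o c))) (fun s c => rel_of A (g \o c)).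
exists A1, alpha; split=> //.
- split.
  + split.
    * move=> a b /eqvE[u -> ->]; split; apply/rd; by exists u.
    * by move=> a /rd[u ->]; apply/eqvE; exists u.
    * by move=> a b /eqvE[u -> ->]; apply/eqvE; exists u.
    * by move=> a b c /eqvE[u -> ->] /eqvE[w /rI -> ->]; apply/eqvE; exists w.
  + move=> f x; rewrite ro; split=> [[c [H1 H2]]|[c H1 H2]].
      exists (alpha \o c) => [i|]; first exact/alphaE.
      apply/alphaE; rewrite H2; congr (r (fun_of A _)).
      by apply: funext => i /=; rewrite alphaK.
    exists (g \o c); split; last exact/alphaE.
    by move=> i; apply/alphaE; rewrite [alpha _]gK.
  + move=> s x; rewrite rp; split=> [[c [H1 H2]]|[c H1 H2]].
      exists (alpha \o c) => [i|]; first exact/alphaE.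
      by congr (rel_of A _): H2; apply: funext => i /=; rewrite alphaK.
    exists (g \o c); split => // i.
    by apply/alphaE; rewrite [alpha _]gK.
- split; first by exists g.
  + move=> f x /=; congr (alpha (fun_of A _)).
    by apply: funext => i /=; rewrite alphaK.
  + move=> s x /=; suff -> : g \o (fun i => alpha (x i)) = x by [].
    by apply: funext => i /=; rewrite alphaK.
Qed.

(** [I] is applied inside the copy [B1] by pushing [rA] along [beta]. As the class [beta u] contains
    only [rB u], the pulled-back graph of the isomorphism is that of the composite coding, [rA]
    followed by [rB]. *)
Lemma codes_definable_iso LA LB P Q (I : interpretation LA LB Q)
    (J : interpretation LB LA P) T (A : structure LA T) (p : P -> T)
    U (B : structure LB U) (q : Q -> U) rA rB F
    (B1 : structure LB (quotient J A p)) beta :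
  codes I B q A rA ->
  isomorphism B B1 beta -> (forall u a, sval (beta u) a <-> a = rB u) ->
  defines A p F (fun x => forall i j, x (Some (i, j)) = rB (rA (x None) i) j) ->
  definable_iso B1 (beta \o q) F.
Proof.
move=> cI iso betaE FE.
have [A2 [h [int2 isoh hE]]] := codes_interprets (codes_iso_target cI iso).
exists A2, h; split=> // x; rewrite FE; split=> [H|[c H1 /hE H2] i j].
  exists (beta \o rA (x None)); last exact/hE.
  by move=> i; apply/betaE/funext => j.
by move: (H1 i); rewrite H2 => /betaE /(congr1 (@^~ j)).
Qed.

Lemma codes_biinterpretation LA LB P Q (I : interpretation LA LB Q)
    (J : interpretation LB LA P) F G T (A : structure LA T) (p : P -> T)
    U (B : structure LB U) (q : Q -> U) rA rB :
  codes I B q A rA -> codes J A p B rB ->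
  defines A p F (fun x => forall i j, x (Some (i, j)) = rB (rA (x None) i) j) ->
  defines B q G (fun x => forall j i, x (Some (j, i)) = rA (rB (x None) j) i) ->
  biinterpretation F G A p B q.
Proof.
move=> cI cJ FE GE.
have [A1 [alpha [intA isoA alphaE]]] := codes_interprets cI.
have [B1 [beta [intB isoB betaE]]] := codes_interprets cJ.
exists A1, alpha, B1, beta; split=> //.
- exact: (codes_definable_iso cI isoB betaE FE).
- exact: (codes_definable_iso cJ isoA alphaE GE).
Qed.

(** * Words as matrices *)

Record mat := Mat { ul : nat; ur : nat; dl : nat; dr : nat }.

Definition mulm (M N : mat) : mat :=
  Mat (ul M * ul N + ur M * dl N) (ul M * ur N + ur M * dr N)
      (dl M * ul N + dr M * dl N) (dl M * ur N + dr M * dr N).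

Definition idm := Mat 1 0 0 1.

(* [det M = 1], without subtraction. *)
Definition det1 (M : mat) : Prop := ul M * dr M = ur M * dl M + 1.

(** [true] stands for the generator A and [false] for B. *)
Definition gen (c : bool) : mat := if c then Mat 1 1 0 1 else Mat 1 0 1 1.

Definition matword (t : seq bool) : mat := foldr (mulm \o gen) idm t.

Lemma eq_mat M N : ul M = ul N -> ur M = ur N -> dl M = dl N -> dr M = dr N ->
  M = N.
Proof. by case: M N => a b c d [a' b' c' d'] /= -> -> -> ->. Qed.

Lemma mulmA : associative mulm.
Proof. by move=> M N Q; apply: eq_mat => /=; lia. Qed.

Lemma mul1m : left_id idm mulm.
Proof. by move=> M; apply: eq_mat => /=; lia. Qed.

Lemma mulm1 : right_id idm mulm.
Proof. by move=> M; apply: eq_mat => /=; lia. Qed.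

Lemma matword_cat s t : matword (s ++ t) = mulm (matword s) (matword t).
Proof. by elim: s => [|c s IH] /=; rewrite ?mul1m // IH mulmA. Qed.

Lemma matword_det1 t : det1 (matword t).
Proof.
elim: t => //= c t; move: (matword t) => [a b c' d].
by rewrite /det1; case: c => /=; nia.
Qed.

(** The first letter can be read off: a left factor A makes the upper row dominate the lower one, a
    left factor B does the reverse, and both at once would make the rows equal, against determinant
    1. *)
Lemma matword_inj : injective matword.
Proof.
have neq1 c t : idm <> matword (c :: t).
  move: (matword_det1 t) => /=; move: (matword t) => [x y z w].
  by rewrite /det1 /mulm /idm; case: c => /= H [] *; nia.
elim=> [|c s IH] [|d t] //; first by move/neq1.
  by move/esym/neq1.
move=> E; have Ecd : c = d.
  move: E (matword_det1 s) (matword_det1 t) => /=; case: (matword s) => x y z w.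
  case: (matword t) => x' y' z' w'; rewrite /det1 /mulm.
  by case: c; case: d => //= -[] *; nia.
subst d; congr cons; apply: IH; move: E => /=.
case: (matword s) (matword t) => x y z w [x' y' z' w']; rewrite /mulm.
by case: c => /= -[] *; apply: eq_mat => /=; lia.
Qed.

(** Euclid's algorithm on rows: unless the matrix is the identity, one row dominates the other, and
    subtracting the smaller row, nonzero by determinant 1, lowers the sum of the entries. *)
Lemma matword_surj M : det1 M -> exists t, M = matword t.
Proof.
have [k] := ubnP (ul M + ur M + dl M + dr M).
elim: k M => // k IH [a b c d]; rewrite ltnS /det1 /= => le_k detM.
have [[le_ca le_db]|[le_ac le_bd]|Eid] :
    [\/ c <= a /\ d <= b, a <= c /\ b <= d | Mat a b c d = idm].
- have [ca|ac] := leqP c a; have [db|bd] := leqP d b.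
  + by constructor 1.
  + have [E|ne_ac] := eqVneq a c; first by constructor 2; lia.
    have lt_ca : c < a by lia.
    (* From c < a and b < d follows (c+1)(b+1) <= ad = bc+1, which forces b = c = 0 and a = d =
       1. *)
    have := leq_mul lt_ca bd; move=> le_ad; constructor 3.
    have [c0 b0] : c = 0 /\ b = 0 by nia.
    by subst; congr Mat; nia.
  (* Here a < c and d <= b give ad <= bc, against determinant 1. *)
  + have := leq_mul ac (leqnn d); have := leq_mul db (leqnn c).
    by have [->|] := eqVneq d 0; nia.
  + by constructor 2; lia.
- have [||t tE] := IH (Mat (a - c) (b - d) c d); rewrite /det1 /=; [nia|nia|].
  exists (true :: t); rewrite /= -tE; apply: eq_mat => /=; lia.
- have [||t tE] := IH (Mat a b (c - a) (d - b)); rewrite /det1 /=; [nia|nia|].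
  exists (false :: t); rewrite /= -tE; apply: eq_mat => /=; lia.
- by exists [::].
Qed.

(** * The submonoid freely generated by the words A^i B with i < n *)

Section Spell.

Variable n : nat.

(* The words [A^i B], [i < n], of the free monoid on [A] and [B] form a prefix
   code. *)
Definition spell (w : seq 'I_n) : seq bool :=
  flatten [seq nseq i true ++ [:: false] | i : 'I_n <- w].

Lemma nseq_false_cat_inj i j s t :
  nseq i true ++ false :: s = nseq j true ++ false :: t -> i = j /\ s = t.
Proof. by elim: i j => [|i IH] [|j] //= [] // /IH[->]. Qed.

Lemma spell_cat u v : spell (u ++ v) = spell u ++ spell v.
Proof. by rewrite /spell map_cat flatten_cat. Qed.

Lemma spell_cons i w : spell (i :: w) = nseq i true ++ false :: spell w.
Proof. by rewrite /spell /= -catA. Qed.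

Lemma spell_inj : injective spell.
Proof.
elim=> [|i u IH] [|j v] //; rewrite ?spell_cons.
- by case: (j : nat).
- by case: (i : nat).
- by move=> /nseq_false_cat_inj[/val_inj -> /IH ->].
Qed.

Lemma spell_last w : last false (spell w) = false.
Proof. by elim: w => // i w IH; rewrite spell_cons last_cat. Qed.

(** If the run starts after the first codeword, that codeword is dropped. Otherwise the [false]
    closing it, at position [i < n], would fall inside the run. *)
Lemma spell_run w u v : 0 < n -> spell w <> u ++ nseq n true ++ v.
Proof.
move=> n_gt0; elim: w u => [|i w IH] u.
  by move/(congr1 size); rewrite !size_cat size_nseq /=; lia.
rewrite spell_cons => E.
have [lt_iu|le_ui] := ltnP i (size u).
  move: (congr1 (drop i.+1) E).
  rewrite -cat_rcons drop_size_cat ?size_rcons ?size_nseq //.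
  by rewrite -(cat_take_drop i.+1 u) -catA drop_size_cat ?size_takel //; apply: IH.
move: (congr1 (nth true ^~ i) E); rewrite nth_cat size_nseq ltnn subnn /=.
rewrite nth_cat ltnNge le_ui /= nth_cat size_nseq.
have -> : i - size u < n by apply: leq_ltn_trans (ltn_ord i); apply: leq_subr.
by rewrite nth_nseq; case: ifP => //; have := ltn_ord i; lia.
Qed.

(** The word is cut after its first [false], which exists because a nonempty [t] ends in [false];
    fewer than [n] letters [true] precede it. The default value of [last] admits the empty word. *)
Lemma spellP t : (forall u v, t <> u ++ nseq n true ++ v) ->
  last false t = false -> exists w, t = spell w.
Proof.
have [k] := ubnP (size t); elim: k t => // k IH t le_k run last_t.
have [->|t_neq0] := eqVneq t [::]; first by exists [::].
have [i [s tE]] : exists i s, t = nseq i true ++ false :: s.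
  elim: t last_t t_neq0 {IH le_k run} => // -[] t IHt /= last_t _; last by exists 0, t.
  have t_neq0 : t != [::] by case: t last_t {IHt}.
  have [|i [s ->]] := IHt _ t_neq0; last by exists i.+1, s.
  by case: t last_t t_neq0 {IHt}.
have lt_in : i < n.
  rewrite ltnNge; apply/negP => le_ni.
  apply: (run [::] (nseq (i - n) true ++ false :: s)).
  by rewrite tE /= catA -nseqD subnKC.
have [||| w sE] := IH s.
- by move: le_k; rewrite tE size_cat /=; lia.
- by move=> u v sE; apply: (run (nseq i true ++ false :: u) v); rewrite tE sE -catA.
- by move: last_t; rewrite tE last_cat.
by exists (Ordinal lt_in :: w); rewrite spell_cons tE sE.
Qed.

Definition code (w : seq 'I_n) : mat := matword (spell w).

Lemma code_cat u v : code (u ++ v) = mulm (code u) (code v).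
Proof. by rewrite /code spell_cat matword_cat. Qed.

Lemma code_inj : injective code.
Proof. by move=> u v /matword_inj/spell_inj. Qed.

Lemma matword_run k : matword (nseq k true) = Mat 1 k 0 1.
Proof. by elim: k => //= k ->; apply: eq_mat => /=; lia. Qed.

(** [Mat i.+1 i 1 1] is A^i B. *)
Lemma code_cons i w : code (i :: w) = mulm (Mat i.+1 i 1 1) (code w).
Proof.
rewrite /code spell_cons matword_cat /= mulmA matword_run.
by congr mulm; apply: eq_mat => /=; lia.
Qed.

Lemma code_nseq (i : 'I_n) k : i = 0 :> nat -> code (nseq k i) = Mat 1 0 k 1.
Proof.
by move=> i0; elim: k => //= k; rewrite code_cons i0 => ->; apply: eq_mat => /=; lia.
Qed.

(** The conditions of [spellP] in first-order form: matrices of determinant 1 play the role of words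
    over A and B, [gen false] is B and [Mat 1 n 0 1] is A^n. *)
Definition is_code (M : mat) : Prop :=
  [/\ det1 M,
      M = idm \/ exists U, det1 U /\ M = mulm U (gen false)
    & ~ exists U V, [/\ det1 U, det1 V & M = mulm (mulm U (Mat 1 n 0 1)) V]].

Lemma is_codeP M : 0 < n -> is_code M <-> exists w, M = code w.
Proof.
move=> n_gt0; split=> [[/matword_surj[t ->] last_t run]|[w ->]].
  have [||w ->] := @spellP t; last by exists w.
  - move=> u v tE; apply: run; exists (matword u), (matword v).
    by rewrite -matword_run -!matword_cat -catA -tE; split=> //; apply: matword_det1.
  - case: last_t => [|[U [/matword_surj[u ->]]]]; first by move/(@matword_inj _ [::]) ->.
    rewrite -(mulm1 (gen false)) -(matword_cat u [:: false]) => /matword_inj ->.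
    by rewrite last_cat.
split; first exact: matword_det1.
- move: (spell_last w); rewrite /code; case/lastP: (spell w) => [|s []].
  + by left.
  + by rewrite last_rcons.
  + move=> _; right; exists (matword s); split; first exact: matword_det1.
    by rewrite -cats1 matword_cat /= mulm1.
- move=> [_ [_ [/matword_surj[u ->] /matword_surj[v ->]]]].
  rewrite -matword_run -!matword_cat -catA => /matword_inj; exact: spell_run.
Qed.

End Spell.

(** * Finite sets of tuples coded by words *)

Section Words.

Variable X : eqType.
Implicit Types (A b u s x y z : seq X).

Definition avoids A u : Prop := ~ exists x y, u = x ++ A ++ y.

Definition delim b A : seq X := b ++ A ++ b.

Definition block b A u1 u2 u3 u4 u5 : seq X :=
  u1 ++ delim b A ++ u2 ++ delim b A ++ u3 ++ delim b A ++ u4 ++ delim b A ++ u5.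

(* [(z, A, A')] codes a finite set of quintuples. Quintuples become words by
   means of the delimiter [bAb], and a list of such words becomes [z] by means
   of the delimiter [bA'b]. *)
Definition coded b z A A' u1 u2 u3 u4 u5 : Prop :=
  (avoids A u1 /\ avoids A u2 /\ avoids A u3 /\ avoids A u4) /\
  (avoids A' (block b A u1 u2 u3 u4 u5) /\
   exists x y, z = x ++ delim b A' ++ block b A u1 u2 u3 u4 u5 ++ delim b A' ++ y).

Definition quinary_relation :=
  seq X -> seq X -> seq X -> seq X -> seq X -> Prop.

(** The set coded by [(z, A, A')] is a certificate: each of its members is a base tuple or comes by
    one step from another member. Quantifying over words thus replaces quantifying over finite
    sets. *)
Definition derivable b (base : quinary_relation)
    (step : seq X -> seq X -> seq X -> seq X -> seq X -> quinary_relation) :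
    quinary_relation := fun u1 u2 u3 u4 u5 =>
  exists z A A', coded b z A A' u1 u2 u3 u4 u5 /\
    forall y1 y2 y3 y4 y5, coded b z A A' y1 y2 y3 y4 y5 ->
      base y1 y2 y3 y4 y5 \/
      exists x1 x2 x3 x4 x5, coded b z A A' x1 x2 x3 x4 x5 /\
        step x1 x2 x3 x4 x5 y1 y2 y3 y4 y5.

Variables (a c : X).
Hypothesis ac : a != c.

Lemma avoids_cat A u v : avoids A (u ++ v) -> avoids A u /\ avoids A v.
Proof.
move=> H; split=> -[x [y E]]; apply: H.
  by exists x, (y ++ v); rewrite E !catA.
by exists (u ++ x), y; rewrite E !catA.
Qed.

Lemma avoids_nseq m u : size u < m -> avoids (nseq m a) u.
Proof. by move=> lt_um [x [y E]]; move: lt_um; rewrite E !size_cat size_nseq; lia. Qed.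

(** A run of [a] cannot cross the letter [c], so it lies within [s]. *)
Lemma nseq_prefix m s x y : nseq m a ++ x = s ++ c :: y ->
  exists s', s = nseq m a ++ s'.
Proof.
elim: m s => [|m IH] [|d s] /=; first by exists [::].
- by exists (d :: s).
- by case=> E; move: ac; rewrite E eqxx.
- by case=> <- /IH[s' ->]; exists s'.
Qed.

(** * Unique readability of words separated by delimiters *)

Section Delimiter.

Variable m : nat.
Hypothesis m_gt0 : 0 < m.
Notation A := (nseq m a).
Notation D := (delim [:: c] A).

(** Otherwise the run of the left delimiter would, by [nseq_prefix], lie inside [s]. *)
Lemma delim_neq s x y : s <> [::] -> avoids A s -> D ++ x <> s ++ D ++ y.
Proof.
case: s => // d s _ avs E; move: E avs => /= [<-]; rewrite -!catA /=.
by move=> /nseq_prefix[s' ->]; apply; exists [:: c], s'.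
Qed.

Lemma delim_inj s t x y : avoids A s -> avoids A t ->
  s ++ D ++ x = t ++ D ++ y -> s = t /\ x = y.
Proof.
elim: s t => [|d s IH] [|d' t] avs avt.
- move=> E; split=> //; move: E; rewrite -!catA /= => -[] /eqP.
  by rewrite eqseq_cat // => /andP[_ /eqP[]].
- by move/delim_neq => [].
- by move/esym/delim_neq => [].
- case=> <- /IH[] => [||-> ->] //.
  + by case: (avoids_cat (u := [:: d]) avs).
  + by case: (avoids_cat (u := [:: d']) avt).
Qed.

(** Two delimiters can overlap only in a shared letter [c], and then [r] would begin with the run
    [A]. *)
Lemma delim_occurrence s r x y : avoids A s -> (forall t, r <> A ++ t) ->
  s ++ D ++ r = x ++ D ++ y ->
  (x = s /\ r = y) \/ exists x', x = s ++ D ++ x' /\ r = x' ++ D ++ y.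
Proof.
move=> + Hr; elim: s x => [|d s IH] x avs.
  case: x => [|d x].
    move=> E; left; split=> //; have avn : avoids A [::] by apply: avoids_nseq.
    by have [] := delim_inj (s := [::]) (t := [::]) avn avn E.
  move=> /= [<-]; rewrite -!catA /= => E.
  have [x' xE] := nseq_prefix E; move: E; rewrite xE -catA.
  move/eqP; rewrite eqseq_cat // eqxx /= => /eqP.
  case: x' xE => [|d' x'] xE /= [].
    by move=> /Hr.
  by move=> <- ->; right; exists x'; rewrite -!catA.
case: x => [|d' x]; first by move/esym/delim_neq => [].
have avs' : avoids A s by case: (avoids_cat (u := [:: d]) avs).
case=> <- /(IH _ avs')[[-> ->]|[x' [-> ->]]]; first by left.
by right; exists x'.
Qed.

(** One more delimiter is put in front where a listing is used, so that neighbouring words share the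
    delimiter between them. *)
Definition listing (l : seq (seq X)) : seq X := flatten [seq s ++ D | s <- l].

Lemma listing_cons s l : listing (s :: l) = s ++ D ++ listing l.
Proof. by rewrite /listing /= -!catA. Qed.

Lemma listing_neq l t : (forall s, s \in l -> avoids A s) -> listing l <> A ++ t.
Proof.
case: l => [_|s l avl]; first by move/(congr1 size); rewrite size_cat size_nseq /=; lia.
rewrite listing_cons /= => /esym/nseq_prefix[s' sE].
by apply: (avl s); rewrite ?mem_head //; exists [::], s'.
Qed.

(** By [delim_occurrence] the delimiter before [u] is one of those separating the list; [delim_inj]
    then identifies [u] with the word that follows it. *)
Lemma mem_listing u l : avoids A u -> (forall s, s \in l -> avoids A s) ->
  (exists x y, D ++ listing l = x ++ D ++ u ++ D ++ y) <-> u \in l.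
Proof.
move=> avu; elim: l => [|s l IH] avl.
  split=> // -[x [y /(congr1 size)]]; rewrite !size_cat /=; lia.
have avs : avoids A s by apply: avl; rewrite mem_head.
have avl' t : t \in l -> avoids A t by move=> tl; apply: avl; rewrite in_cons tl orbT.
have av0 : avoids A [::] by apply: avoids_nseq.
have nstart := listing_neq; split.
  move=> [x [y E]]; rewrite in_cons.
  have [[_]|[x' [_]]] := delim_occurrence (s := [::]) av0 (fun t => @nstart _ t avl) E.
    by rewrite listing_cons => /(delim_inj avs avu)[-> _]; rewrite eqxx.
  rewrite listing_cons => {}E.
  apply/orP; right; apply/(IH avl').
  have [[_ ->]|[x'' [_ ->]]] := delim_occurrence avs (fun t => @nstart _ t avl') E.
    by exists [::], y.
  by exists (D ++ x''), y; rewrite -!catA.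
rewrite in_cons => /orP[/eqP ->|/(IH avl')[x [y E]]].
  by exists [::], (listing l); rewrite listing_cons.
by exists (D ++ s ++ x), y; rewrite listing_cons E -!catA.
Qed.

End Delimiter.

(** The first four words are peeled off one delimiter at a time; the fifth is what remains. *)
Lemma block_inj m u1 u2 u3 u4 u5 v1 v2 v3 v4 v5 : 
  let A := nseq m a in
  avoids A u1 /\ avoids A u2 /\ avoids A u3 /\ avoids A u4 ->
  avoids A v1 /\ avoids A v2 /\ avoids A v3 /\ avoids A v4 ->
  block [:: c] A u1 u2 u3 u4 u5 = block [:: c] A v1 v2 v3 v4 v5 ->
  (u1, u2, u3, u4, u5) = (v1, v2, v3, v4, v5).
Proof.
move=> A [Hu1 [Hu2 [Hu3 Hu4]]] [Hv1 [Hv2 [Hv3 Hv4]]].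
move=> /(delim_inj Hu1 Hv1)[-> /(delim_inj Hu2 Hv2)[->]].
by move=> /(delim_inj Hu3 Hv3)[-> /(delim_inj Hu4 Hv4)[-> ->]].
Qed.

Lemma coded_exists (l : seq (seq X * seq X * seq X * seq X * seq X)) :
  exists z A A', forall u1 u2 u3 u4 u5,
    coded [:: c] z A A' u1 u2 u3 u4 u5 <-> (u1, u2, u3, u4, u5) \in l.
Proof.
(* [m] exceeds the length of every component and [m'] that of every block, so the runs are too long
   to occur in them. *)
pose m := (\max_(t <- l)
  \max_(s <- [:: t.1.1.1.1; t.1.1.1.2; t.1.1.2; t.1.2; t.2]) size s).+1.
pose bl t := block [:: c] (nseq m a) t.1.1.1.1 t.1.1.1.2 t.1.1.2 t.1.2 t.2.
pose m' := (\max_(t <- l) size (bl t)).+1.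
have short t : t \in l -> [/\ avoids (nseq m a) t.1.1.1.1,
    avoids (nseq m a) t.1.1.1.2, avoids (nseq m a) t.1.1.2 & avoids (nseq m a) t.1.2].
  move=> tl; have H s : s \in [:: t.1.1.1.1; t.1.1.1.2; t.1.1.2; t.1.2; t.2] ->
      avoids (nseq m a) s.
    move=> st; apply: avoids_nseq; rewrite ltnS.
    by apply: leq_trans (leq_bigmax_seq _ tl _) => //; apply: (leq_bigmax_seq _ st).
  by split; apply: H; rewrite !in_cons eqxx ?orbT.
have short' t : t \in l -> avoids (nseq m' a) (bl t).
  by move=> tl; apply: avoids_nseq; rewrite ltnS; apply: (leq_bigmax_seq _ tl).
exists (delim [:: c] (nseq m' a) ++ listing m' (map bl l)), (nseq m a), (nseq m' a).
move=> u1 u2 u3 u4 u5.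
have short'' s : s \in map bl l -> avoids (nseq m' a) s by case/mapP=> t /short' + ->.
split=> [[avu [avb]]|ul].
  move/(mem_listing (ltn0Sn _) avb short''); case/mapP => t tl.
  have [H1 H2 H3 H4] := short _ tl.
  move/block_inj => /(_ avu (conj H1 (conj H2 (conj H3 H4)))) ->.
  by move: tl; case: t {H1 H2 H3 H4} => [[[[]]]].
have [H1 H2 H3 H4] := short _ ul; split=> //.
have := short' _ ul; split=> //.
by apply/(mem_listing (ltn0Sn _)) => //; apply: (map_f bl ul).
Qed.

(* Derivations are well-founded because [step] lengthens the first component,
   so that every finite set closed under taking predecessors will do. *)
Lemma derivableP (base T : quinary_relation)
    (step : seq X -> seq X -> seq X -> seq X -> seq X -> quinary_relation) :
  (forall x1 x2 x3 x4 x5 y1 y2 y3 y4 y5,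
    step x1 x2 x3 x4 x5 y1 y2 y3 y4 y5 -> size x1 < size y1) ->
  (forall y1 y2 y3 y4 y5, T y1 y2 y3 y4 y5 <-> base y1 y2 y3 y4 y5 \/
    exists x1 x2 x3 x4 x5, T x1 x2 x3 x4 x5 /\ step x1 x2 x3 x4 x5 y1 y2 y3 y4 y5) ->
  forall y1 y2 y3 y4 y5, derivable [:: c] base step y1 y2 y3 y4 y5 <-> T y1 y2 y3 y4 y5.
Proof.
move=> incr TE y1 y2 y3 y4 y5; split.
  move=> [z [A [A' [+ Hz]]]].
  have [k] := ubnP (size y1); elim: k y1 y2 y3 y4 y5 => // k IH y1 y2 y3 y4 y5.
  rewrite ltnS => le_k /Hz[?|[x1 [x2 [x3 [x4 [x5 [Hx st]]]]]]]; apply/TE; first by left.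
  right; exists x1, x2, x3, x4, x5; split=> //; apply: IH Hx.
  exact: leq_trans (incr _ _ _ _ _ _ _ _ _ _ st) le_k.
move=> Ty.
(* The list is a chain of predecessors leading from the tuple down to a base tuple. *)
have [l yl Hl] : exists2 l : seq (seq X * seq X * seq X * seq X * seq X),
    (y1, y2, y3, y4, y5) \in l &
    forall y1 y2 y3 y4 y5, (y1, y2, y3, y4, y5) \in l -> base y1 y2 y3 y4 y5 \/
      exists x1 x2 x3 x4 x5, (x1, x2, x3, x4, x5) \in l /\
        step x1 x2 x3 x4 x5 y1 y2 y3 y4 y5.
  have [k] := ubnP (size y1); elim: k y1 y2 y3 y4 y5 Ty => // k IH y1 y2 y3 y4 y5.
  rewrite ltnS => /TE[Hb|[x1 [x2 [x3 [x4 [x5 [Tx st]]]]]]] le_k.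
    exists [:: (y1, y2, y3, y4, y5)]; first by rewrite mem_head.
    by move=> z1 z2 z3 z4 z5; rewrite inE => /eqP[-> -> -> -> ->]; left.
  have [l xl Hl] := IH _ _ _ _ _ Tx (leq_trans (incr _ _ _ _ _ _ _ _ _ _ st) le_k).
  exists ((y1, y2, y3, y4, y5) :: l); first by rewrite mem_head.
  move=> z1 z2 z3 z4 z5; rewrite in_cons => /orP[/eqP[-> -> -> -> ->]|/Hl].
    by right; exists x1, x2, x3, x4, x5; rewrite in_cons xl orbT.
  case=> [|[w1 [w2 [w3 [w4 [w5 [wl Hw]]]]]]]; first by left.
  by right; exists w1, w2, w3, w4, w5; rewrite in_cons wl orbT.
have [z [A [A' Hz]]] := coded_exists l.
exists z, A, A'; split; first exact/Hz.
move=> z1 z2 z3 z4 z5 /Hz/Hl[|[x1 [x2 [x3 [x4 [x5 [xl st]]]]]]]; first by left.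
by right; exists x1, x2, x3, x4, x5; split=> //; apply/Hz.
Qed.

End Words.

(** * Definable relations *)

Section Definability.

Variables (L : language) (T : Type) (M : structure L T).

Definition definable V (S : (V -> T) -> Prop) : Prop :=
  exists F : formula L V, forall v, sat M v F <-> S v.

Definition tdefinable V (s : (V -> T) -> T) : Prop :=
  exists t : term L V, forall v, eval M v t = s v.

Variable V : Type.
Implicit Types (R S : (V -> T) -> Prop) (s t : (V -> T) -> T).

Lemma definable_eq s t :
  tdefinable s -> tdefinable t -> definable (fun v => s v = t v).
Proof. by move=> [s' sE] [t' tE]; exists (Eq s' t') => v /=; rewrite sE tE. Qed.

Lemma definable_imp R S :
  definable R -> definable S -> definable (fun v => R v -> S v).
Proof. by move=> [F FE] [G GE]; exists (Imp F G) => v /=; rewrite FE GE. Qed.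

Lemma definable_and R S :
  definable R -> definable S -> definable (fun v => R v /\ S v).
Proof. by move=> [F FE] [G GE]; exists (And F G) => v /=; rewrite FE GE. Qed.

Lemma definable_or R S :
  definable R -> definable S -> definable (fun v => R v \/ S v).
Proof. by move=> [F FE] [G GE]; exists (Or F G) => v /=; rewrite FE GE. Qed.

Lemma definable_and3 R S S' : definable R -> definable S -> definable S' ->
  definable (fun v => [/\ R v, S v & S' v]).
Proof.
move=> [F FE] [G GE] [H HE]; exists (And F (And G H)) => v /=.
by rewrite FE GE HE; split=> [[? []]|[]].
Qed.

Lemma definable_not S : definable S -> definable (fun v => ~ S v).
Proof. by move=> [F FE]; exists (Imp F (Bot _ _)) => v /=; rewrite FE. Qed.

Lemma definable_all (S : T -> (V -> T) -> Prop) :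
  definable (fun v : option V -> T => S (v None) (fun x => v (Some x))) ->
  definable (fun v => forall a, S a v).
Proof.
move=> [F FE]; exists (All F) => v.
split=> H a; first exact: (proj1 (FE (oapp v a)) (H a)).
exact: (proj2 (FE (oapp v a)) (H a)).
Qed.

Lemma definable_ex (S : T -> (V -> T) -> Prop) :
  definable (fun v : option V -> T => S (v None) (fun x => v (Some x))) ->
  definable (fun v => exists a, S a v).
Proof.
move=> [F FE]; exists (Ex F) => v.
split=> -[a Ha]; exists a; first exact: (proj1 (FE (oapp v a)) Ha).
exact: (proj2 (FE (oapp v a)) Ha).
Qed.

(** An index from a fixed finite type is not an element of the structure; its quantifier becomes a
    finite disjunction. *)
Lemma definable_ex_fin (I : finType) (S : I -> (V -> T) -> Prop) :
  (forall i, definable (S i)) -> definable (fun v => exists i, S i v).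
Proof.
move=> H; suff [F FE] : definable (fun v => exists2 i, i \in enum I & S i v).
  by exists F => v; rewrite FE; split=> -[i]; exists i; rewrite ?mem_enum.
elim: (enum I) => [|i e [F FE]]; first by exists (Bot _ _) => v; split=> // -[].
have [G GE] := H i; exists (Or G F) => v /=; rewrite GE FE; split.
  by move=> [Si|[j je Sj]]; [exists i|exists j]; rewrite ?mem_head // in_cons je orbT.
move=> [j]; rewrite in_cons => /orP[/eqP ->|je] Sj; first by left.
by right; exists j.
Qed.

Lemma tdefinable_var x : tdefinable (fun v : V -> T => v x).
Proof. by exists (Var L x). Qed.

End Definability.

Lemma defines_definable L T (M : structure L T) P (p : P -> T) V
    (R : (P + V -> T) -> Prop) S :
  definable M R -> (forall v, R (join p v) <-> S v) ->
  exists F : formula L (P + V), defines M p F S.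
Proof. by move=> [F FE] RS; exists F => v; rewrite FE. Qed.

(** * Terms of the two languages, and matrices as quadruples of variables *)

Definition no_args (A : Type) (i : 'I_0) : A := False_rect A (notF (ltn_ord i)).

Section ArithmeticTerms.

Variable V : Type.
Implicit Types s t : (V -> nat) -> nat.
Notation tdefinable := (tdefinable standard_arithmetic).

Lemma tdefinable_add s t :
  tdefinable s -> tdefinable t -> tdefinable (fun v => s v + t v).
Proof.
move=> [s' sE] [t' tE].
exists (@App arith_language V ArAdd (fun i => if val i is 0 then s' else t')) => v /=.
by rewrite sE tE.
Qed.

Lemma tdefinable_mul s t :
  tdefinable s -> tdefinable t -> tdefinable (fun v => s v * t v).
Proof.
move=> [s' sE] [t' tE].
exists (@App arith_language V ArMul (fun i => if val i is 0 then s' else t')) => v /=.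
by rewrite sE tE.
Qed.

Lemma tdefinable_const k : tdefinable (fun _ : V -> nat => k).
Proof.
elim: k => [|k IH].
  by exists (@App arith_language V ArZero (@no_args _)).
have [t tE] : tdefinable (fun _ : V -> nat => k + 1).
  apply: tdefinable_add => //.
  by exists (@App arith_language V ArOne (@no_args _)).
by exists t => v; rewrite tE addn1.
Qed.

End ArithmeticTerms.

Section MonoidTerms.

Variables (V X : Type).
Implicit Types s t : (V -> seq X) -> seq X.
Notation tdefinable := (tdefinable (free_monoid X)).

Lemma tdefinable_cat s t :
  tdefinable s -> tdefinable t -> tdefinable (fun v => s v ++ t v).
Proof.
move=> [s' sE] [t' tE].
exists (@App monoid_language V MonMul (fun i => if val i is 0 then s' else t')) => v /=.
by rewrite sE tE.
Qed.

Lemma tdefinable_nil : tdefinable (fun _ : V -> seq X => [::]).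
Proof.
by exists (@App monoid_language V MonOne (@no_args _)).
Qed.

(** [flatten (nseq k (s v))] is the [k]-th power of [s v], with [k] fixed outside the formula. *)
Lemma tdefinable_pow k s : tdefinable s -> tdefinable (fun v => flatten (nseq k (s v))).
Proof.
move=> ds; elim: k => [|k IH] /=; first exact: tdefinable_nil.
exact: tdefinable_cat.
Qed.

End MonoidTerms.

(** One matrix quantifier becomes four number quantifiers; the innermost, [None], binds the entry
    [dr]. *)
Lemma definable_ex_mat V (S : mat -> (V -> nat) -> Prop) :
  definable standard_arithmetic (fun v : option (option (option (option V))) -> nat =>
    S (Mat (v (Some (Some (Some None)))) (v (Some (Some None))) (v (Some None)) (v None))
      (fun x => v (Some (Some (Some (Some x)))))) ->
  definable standard_arithmetic (fun v => exists U, S U v).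
Proof.
move=> H; suff [F FE] : definable standard_arithmetic
    (fun v => exists a b c d, S (Mat a b c d) v).
  exists F => v; rewrite FE; split=> [[a [b [c [d]]]]|[[a b c d]]].
    by exists (Mat a b c d).
  by exists a, b, c, d.
by do 4 (apply: definable_ex; cbv beta).
Qed.

Lemma definable_eq_mat V (s t : (V -> nat) -> mat) :
  let D := definable standard_arithmetic in
  D V (fun v => ul (s v) = ul (t v)) -> D V (fun v => ur (s v) = ur (t v)) ->
  D V (fun v => dl (s v) = dl (t v)) -> D V (fun v => dr (s v) = dr (t v)) ->
  D V (fun v => s v = t v).
Proof.
move=> D H1 H2 H3 H4.
have [F FE] := definable_and H1 (definable_and H2 (definable_and H3 H4)).
exists F => v; rewrite FE; split=> [[? [? []]]|->//]; exact: eq_mat.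
Qed.

Ltac definability := repeat first
  [ progress cbv beta
  | apply definable_and3 | apply definable_and | apply definable_or
  | apply definable_not | apply definable_ex | apply definable_ex_fin; intro
  | apply definable_ex_mat; cbn [ul ur dl dr]
  | apply definable_all | apply definable_imp
  | apply definable_eq | apply definable_eq_mat; cbn [ul ur dl dr gen idm mulm]
  | apply tdefinable_var
  | apply tdefinable_cat | apply tdefinable_nil | apply tdefinable_pow
  | apply tdefinable_add | apply tdefinable_mul | apply tdefinable_const ].

Lemma forall_ord2 (P : 'I_2 -> Prop) :
  P (@Ordinal 2 0 isT) -> P (@Ordinal 2 1 isT) -> forall i, P i.
Proof.
move=> P0 P1 [[|[|//]] lt].
- by rewrite (_ : Ordinal lt = @Ordinal 2 0 isT); last exact: val_inj.
- by rewrite (_ : Ordinal lt = @Ordinal 2 1 isT); last exact: val_inj.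
Qed.

Lemma forall_ord4 (P : 'I_4 -> Prop) :
  P (@Ordinal 4 0 isT) -> P (@Ordinal 4 1 isT) -> P (@Ordinal 4 2 isT) ->
  P (@Ordinal 4 3 isT) -> forall i, P i.
Proof.
move=> P0 P1 P2 P3 [[|[|[|[|//]]]] lt].
- by rewrite (_ : Ordinal lt = @Ordinal 4 0 isT); last exact: val_inj.
- by rewrite (_ : Ordinal lt = @Ordinal 4 1 isT); last exact: val_inj.
- by rewrite (_ : Ordinal lt = @Ordinal 4 2 isT); last exact: val_inj.
- by rewrite (_ : Ordinal lt = @Ordinal 4 3 isT); last exact: val_inj.
Qed.

Definition matv (a : 'I_4 -> nat) : mat :=
  Mat (a (@Ordinal 4 0 isT)) (a (@Ordinal 4 1 isT))
      (a (@Ordinal 4 2 isT)) (a (@Ordinal 4 3 isT)).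

Definition entry (M : mat) (i : 'I_4) : nat :=
  nth 0 [:: ul M; ur M; dl M; dr M] i.

Lemma eq_entry a M : a = entry M <-> matv a = M.
Proof.
split=> [->|<-]; first by case: M.
by apply: funext; apply: forall_ord4.
Qed.

Definition pair_fun T (x y : T) (i : 'I_2) : T := if val i is 0 then x else y.

(** * The two interpretations *)

Section MonoidInArithmetic.

Variable n : nat.
Hypothesis n_gt0 : 0 < n.

Definition code_rep (w : seq 'I_n) : 'I_4 -> nat := entry (code w).

Lemma code_repP a : (exists w, a = code_rep w) <-> is_code n (matv a).
Proof.
by rewrite is_codeP //; split=> -[w /eq_entry]; exists w => //; apply/eq_entry.
Qed.

Lemma monoid_in_arithmetic : exists dom eqv ops preds,
  codes (@Interpretation monoid_language arith_language void 4 dom eqv ops preds)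
    standard_arithmetic (of_void nat) (free_monoid 'I_n) code_rep.
Proof.
(* Block [i] of a tuple, read as a matrix. *)
pose mv W (x : W * 'I_4 -> nat) i := matv (fun j => x (i, j)).
have [dom domE] : exists F, defines standard_arithmetic (of_void nat) F
    (fun a => exists w, a = code_rep w).
  apply: (@defines_definable _ _ _ _ _ _ (fun v => is_code n (matv (v \o inr)))).
    by rewrite /is_code /det1 /matv /=; definability.
  by move=> v; rewrite code_repP.
have [eqv eqvE] : exists F, defines standard_arithmetic (of_void nat) F
    (fun x => exists w, x \o inl = code_rep w /\ x \o inr = code_rep w).
  apply: (@defines_definable _ _ _ _ _ _ (fun v =>
    is_code n (matv (v \o inr \o inl)) /\
    matv (v \o inr \o inl) = matv (v \o inr \o inr))).
    by rewrite /is_code /det1 /matv /=; definability.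
  move=> v; rewrite -code_repP; split=> [[[w H1] H2]|[w [H1 H2]]]; last first.
    by split; [exists w|rewrite [LHS](congr1 matv H1) [RHS](congr1 matv H2)].
  exists w; split=> //; apply/eq_entry; rewrite -[LHS]H2; exact/eq_entry.
have [mul mulE] : exists F, defines standard_arithmetic (of_void nat) F
    (fun x : option 'I_2 * 'I_4 -> nat => exists c : 'I_2 -> seq 'I_n,
      (forall i, (fun j => x (Some i, j)) = code_rep (c i)) /\
      (fun j => x (None, j)) = code_rep (fun_of (free_monoid 'I_n) (f := MonMul) c)).
  apply: (@defines_definable _ _ _ _ _ _ (fun v : void + option 'I_2 * 'I_4 -> nat =>
    is_code n (mv _ (v \o inr) (Some (@Ordinal 2 0 isT))) /\
    is_code n (mv _ (v \o inr) (Some (@Ordinal 2 1 isT))) /\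
    mv _ (v \o inr) None = mulm (mv _ (v \o inr) (Some (@Ordinal 2 0 isT)))
                                (mv _ (v \o inr) (Some (@Ordinal 2 1 isT))))).
    by rewrite /is_code /det1 /mv /matv /=; definability.
  move=> v; rewrite -!code_repP; split=> [[[u Hu] [[w Hw] H]]|[c [H1 H2]]].
    exists (pair_fun u w); split; first exact: forall_ord2.
    apply/eq_entry; rewrite /= code_cat [LHS]H.
    by congr mulm; apply/eq_entry.
  split; first by exists (c (@Ordinal 2 0 isT)).
  split; first by exists (c (@Ordinal 2 1 isT)).
  move/eq_entry: H2 => /= H2; rewrite [LHS]H2 code_cat.
  by congr mulm; apply/esym/eq_entry.
have [one oneE] : exists F, defines standard_arithmetic (of_void nat) F
    (fun x : option 'I_0 * 'I_4 -> nat => exists c : 'I_0 -> seq 'I_n,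
      (forall i, (fun j => x (Some i, j)) = code_rep (c i)) /\
      (fun j => x (None, j)) = code_rep (fun_of (free_monoid 'I_n) (f := MonOne) c)).
  apply: (@defines_definable _ _ _ _ _ _ (fun v : void + option 'I_0 * 'I_4 -> nat =>
    mv _ (v \o inr) None = idm)).
    by rewrite /mv /matv /=; definability.
  move=> v; split=> [H|[c [_ /eq_entry]] //].
  exists (fun=> [::]); split; [by case|exact/eq_entry].
exists dom, eqv, (fun f => match f
    return formula arith_language (void + option 'I_(@far monoid_language f) * 'I_4)
    with MonMul => mul | MonOne => one end),
  (fun r : void => match r with end).
split=> //; last by case.
move=> u w E; apply: code_inj; rewrite -(proj1 (eq_entry _ _) E).
exact/esym/eq_entry.
Qed.

End MonoidInArithmetic.

(** * Arithmetic interpreted in the free monoid, and the graphs of the two composite codings *)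

Section ArithmeticInMonoid.

Variables (n : nat) (i0 i1 : 'I_n).
Hypothesis neq01 : i0 != i1.

Notation word := (seq 'I_n).
Notation letter := (fun i : 'I_n => [:: i]).

Definition unary_rep (k : nat) (_ : 'I_1) : word := nseq k i0.

Lemma nseq_inj (X : eqType) (x : X) : injective (nseq ^~ x).
Proof. by move=> k l /(congr1 size); rewrite !size_nseq. Qed.

(** Commuting with x_0 forces a nonempty word to begin with x_0, and the rest commutes again. *)
Lemma commutesP (x : word) :
  x ++ [:: i0] = [:: i0] ++ x <-> exists k, x = nseq k i0.
Proof.
split=> [|[k ->]]; last by elim: k => //= k ->.
elim: x => [_|d x IH /= [-> /IH[k ->]]]; first by exists 0.
by exists k.+1.
Qed.

Lemma eq_unary_rep a k : a = unary_rep k <-> a ord0 = nseq k i0.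
Proof. by split=> [->//|E]; apply: funext => j; rewrite ord1 E. Qed.

Lemma unary_repP a : (exists k, a = unary_rep k) <->
  a ord0 ++ [:: i0] = [:: i0] ++ a ord0.
Proof.
by rewrite commutesP; split=> -[k /eq_unary_rep]; exists k => //; apply/eq_unary_rep.
Qed.

(* The pairs [(x^i, v^i)]. *)
Definition power_pairs (b x v y1 y2 : word) : Prop :=
  derivable b
    (fun y1 y2 y3 y4 y5 => y1 = [::] /\ y2 = [::] /\ y3 = [::] /\ y4 = [::] /\ y5 = [::])
    (fun x1 x2 x3 x4 x5 y1 y2 y3 y4 y5 =>
      y1 = x ++ x1 /\ y2 = v ++ x2 /\ y3 = [::] /\ y4 = [::] /\ y5 = [::])
    y1 y2 [::] [::] [::].

(** The first component counts, in powers of x_0, how often x_0^j has been added, so the graph of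
    multiplication results. *)
Lemma power_pairsP i j y : 
  power_pairs [:: i1] [:: i0] (nseq j i0) (nseq i i0) y <-> y = nseq (i * j) i0.
Proof.
rewrite /power_pairs (derivableP neq01 (T := fun y1 y2 y3 y4 y5 => exists k,
  y1 = nseq k i0 /\ y2 = nseq (k * j) i0 /\ y3 = [::] /\ y4 = [::] /\ y5 = [::])).
- split=> [[k [/nseq_inj -> [-> _]]]//|->]; by exists i.
- by move=> x1 x2 x3 x4 x5 y1 y2 y3 y4 y5 [-> _].
- move=> y1 y2 y3 y4 y5; split.
  + move=> [[|k] [-> [-> [-> [-> ->]]]]]; first by left.
    right; exists (nseq k i0), (nseq (k * j) i0), [::], [::], [::]; split.
      by exists k.
    by rewrite mulSn nseqD.
  + case=> [[-> [-> [-> [-> ->]]]]|[x1 [x2 [x3 [x4 [x5 [[k [-> [-> _]]]]]]]]]].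
      by exists 0.
    move=> [-> [-> [-> [-> ->]]]]; exists k.+1.
    by rewrite mulSn nseqD.
Qed.

Lemma arithmetic_in_monoid : exists dom eqv ops preds,
  codes (@Interpretation arith_language monoid_language 'I_n 1 dom eqv ops preds)
    (free_monoid 'I_n) letter standard_arithmetic unary_rep.
Proof.
pose num (a x : word) := x ++ a = a ++ x.
have [dom domE] : exists F, defines (free_monoid 'I_n) letter F
    (fun a => exists k, a = unary_rep k).
  apply: (@defines_definable _ _ _ _ _ _ (fun v => num (v (inl i0)) (v (inr ord0)))).
    by rewrite /num; definability.
  by move=> v; rewrite unary_repP.
have [eqv eqvE] : exists F, defines (free_monoid 'I_n) letter F
    (fun x => exists k, x \o inl = unary_rep k /\ x \o inr = unary_rep k).
  apply: (@defines_definable _ _ _ _ _ _ (fun v =>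
    num (v (inl i0)) (v (inr (inl ord0))) /\ v (inr (inl ord0)) = v (inr (inr ord0)))).
    by rewrite /num; definability.
  move=> v; rewrite [num _ _]commutesP.
  split=> [[[k H1] /= H2]|[k [/eq_unary_rep H1 /eq_unary_rep H2]]].
    by exists k; split; apply/eq_unary_rep; rewrite /= -?H2.
  by split; [exists k|rewrite [LHS]H1 [RHS]H2].
(* Addition and multiplication share this scheme: [R] receives the letters x_0 and x_1, the two
   arguments and the value. *)
have binary g (R : word -> word -> word -> word -> word -> Prop) :
    (forall k l y, R [:: i0] [:: i1] (nseq k i0) (nseq l i0) y <-> y = nseq (g k l) i0) ->
    definable (free_monoid 'I_n) (fun v : 'I_n + option 'I_2 * 'I_1 -> word =>
      R (v (inl i0)) (v (inl i1)) (v (inr (Some (@Ordinal 2 0 isT), ord0)))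
        (v (inr (Some (@Ordinal 2 1 isT), ord0))) (v (inr (None, ord0)))) ->
    exists F, defines (free_monoid 'I_n) letter F
      (fun x : option 'I_2 * 'I_1 -> word => exists c : 'I_2 -> nat,
        (forall i, (fun j => x (Some i, j)) = unary_rep (c i)) /\
        (fun j => x (None, j)) =
           unary_rep (g (c (@Ordinal 2 0 isT)) (c (@Ordinal 2 1 isT)))).
  move=> RE [FR FRE].
  apply: (@defines_definable _ _ _ _ _ _ (fun v : 'I_n + option 'I_2 * 'I_1 -> word =>
    num (v (inl i0)) (v (inr (Some (@Ordinal 2 0 isT), ord0))) /\
    num (v (inl i0)) (v (inr (Some (@Ordinal 2 1 isT), ord0))) /\
    R (v (inl i0)) (v (inl i1)) (v (inr (Some (@Ordinal 2 0 isT), ord0)))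
        (v (inr (Some (@Ordinal 2 1 isT), ord0))) (v (inr (None, ord0))))).
    by rewrite /num; definability; exists FR.
  move=> v; rewrite ![num _ _]commutesP /=.
  split=> [[[k Hk] [[l Hl]]]|[c [H1 /eq_unary_rep H2]]].
    rewrite Hk Hl RE => H; exists (pair_fun k l); split; last exact/eq_unary_rep.
    by apply: forall_ord2; apply/eq_unary_rep.
  have /eq_unary_rep E0 := H1 (@Ordinal 2 0 isT).
  have /eq_unary_rep E1 := H1 (@Ordinal 2 1 isT).
  by rewrite E0 E1 RE; split; [eexists|split; [eexists|]].
have [add addE] := binary addn (fun _ _ x y z => z = x ++ y)
  (fun k l y => ltac:(by rewrite nseqD)) ltac:(by definability).
have [mul mulE] : exists F, defines (free_monoid 'I_n) letter F
      (fun x : option 'I_2 * 'I_1 -> word => exists c : 'I_2 -> nat,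
        (forall i, (fun j => x (Some i, j)) = unary_rep (c i)) /\
        (fun j => x (None, j)) =
           unary_rep (c (@Ordinal 2 0 isT) * c (@Ordinal 2 1 isT))).
  (* [x] counts the iterations and [y] is the word repeated. *)
  apply: (binary muln (fun a b x y z => power_pairs b a y x z)).
    by move=> k l y; apply: power_pairsP.
  by rewrite /power_pairs /derivable /coded /avoids /block /delim; definability.
have nullary k : exists F, defines (free_monoid 'I_n) letter F
    (fun x : option 'I_0 * 'I_1 -> word => exists c : 'I_0 -> nat,
      (forall i, (fun j => x (Some i, j)) = unary_rep (c i)) /\
      (fun j => x (None, j)) = unary_rep k).
  apply: (@defines_definable _ _ _ _ _ _ (fun v : 'I_n + option 'I_0 * 'I_1 -> word =>
    v (inr (None, ord0)) = flatten (nseq k (v (inl i0))))).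
    by definability.
  have E : flatten (nseq k [:: i0]) = nseq k i0 by elim: (k) => //= m ->.
  move=> v /=; rewrite E; split=> [H|[c [_ /eq_unary_rep]]//].
  exists (fun=> 0); split; [by case|exact/eq_unary_rep].
have [zero zeroE] := nullary 0; have [one oneE] := nullary 1.
exists dom, eqv, (fun f => match f
    return formula monoid_language ('I_n + option 'I_(@far arith_language f) * 'I_1)
    with ArAdd => add | ArMul => mul | ArZero => zero | ArOne => one end),
  (fun r : void => match r with end).
split=> //; last by case.
by move=> k l /eq_unary_rep/nseq_inj.
Qed.

(** A word is followed by its four matrix entries in unary. Prepending the letter [i] multiplies on
    the left by A^i B, as in [code_cons]; the base case is the identity matrix, with [a] for 1 and
    the empty word for 0. *)
Definition code_graph (l : 'I_n -> word) (a b : word) : quinary_relation 'I_n :=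
  derivable b
    (fun y1 y2 y3 y4 y5 => y1 = [::] /\ y2 = a /\ y3 = [::] /\ y4 = [::] /\ y5 = a)
    (fun x1 x2 x3 x4 x5 y1 y2 y3 y4 y5 => exists i : 'I_n,
      y1 = l i ++ x1 /\
      y2 = flatten (nseq i.+1 x2) ++ flatten (nseq i x4) /\
      y3 = flatten (nseq i.+1 x3) ++ flatten (nseq i x5) /\
      y4 = x2 ++ x4 /\ y5 = x3 ++ x5).

Lemma flatten_nseq2 (X : Type) (x : X) k m :
  flatten (nseq k (nseq m x)) = nseq (k * m) x.
Proof. by elim: k => //= k ->; rewrite mulSn nseqD. Qed.

Lemma code_graphP w y1 y2 y3 y4 :
  code_graph letter [:: i0] [:: i1] w y1 y2 y3 y4 <->
  [/\ y1 = nseq (ul (code w)) i0, y2 = nseq (ur (code w)) i0,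
      y3 = nseq (dl (code w)) i0 & y4 = nseq (dr (code w)) i0].
Proof.
rewrite /code_graph (derivableP neq01 (T := fun w y1 y2 y3 y4 =>
  [/\ y1 = nseq (ul (code w)) i0, y2 = nseq (ur (code w)) i0,
      y3 = nseq (dl (code w)) i0 & y4 = nseq (dr (code w)) i0])) //.
  by move=> x1 x2 x3 x4 x5 z1 z2 z3 z4 z5 [i [-> _]].
move=> z1 z2 z3 z4 z5; split.
  case: z1 => [|i z1] [-> -> -> ->]; first by left.
  right; exists z1, (nseq (ul (code z1)) i0), (nseq (ur (code z1)) i0),
    (nseq (dl (code z1)) i0), (nseq (dr (code z1)) i0); split=> //.
  exists i; cbv beta.
  by rewrite code_cons !flatten_nseq2 -!nseqD /= !mul1n.
case=> [[-> [-> [-> [-> ->]]]]|] //.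
move=> [x1 [x2 [x3 [x4 [x5 [[-> -> -> ->] [i [-> [-> [-> [-> ->]]]]]]]]]]].
by rewrite code_cons !flatten_nseq2 -!nseqD /= !mul1n.
Qed.

Lemma definable_code_graph :
  exists F : formula monoid_language ('I_n + option ('I_4 * 'I_1)),
  defines (free_monoid 'I_n) letter F
    (fun x => forall i j, x (Some (i, j)) = unary_rep (code_rep (x None) i) j).
Proof.
apply: (@defines_definable _ _ _ _ _ _ (fun v : 'I_n + option ('I_4 * 'I_1) -> word =>
  code_graph (fun i => v (inl i)) (v (inl i0)) (v (inl i1)) (v (inr None))
    (v (inr (Some (@Ordinal 4 0 isT, ord0)))) (v (inr (Some (@Ordinal 4 1 isT, ord0))))
    (v (inr (Some (@Ordinal 4 2 isT, ord0)))) (v (inr (Some (@Ordinal 4 3 isT, ord0)))))).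
  by rewrite /code_graph /derivable /coded /avoids /block /delim; definability.
move=> v; rewrite [code_graph _ _ _ _ _ _ _ _]code_graphP /=; split=> [[H0 H1 H2 H3]|H].
  by move=> + j; rewrite ord1; apply: forall_ord4.
by split; rewrite H.
Qed.

(** The letter of index 0 is spelled B, so the number k goes to x_0^k and then to B^k, whose entries
    are terms in k. *)
Lemma definable_unary_graph :
  i0 = 0 :> nat ->
  exists G : formula arith_language (void + option ('I_1 * 'I_4)),
  defines standard_arithmetic (of_void nat) G
    (fun x => forall j i, x (Some (j, i)) = code_rep (unary_rep (x None) j) i).
Proof.
move=> i00; apply: (@defines_definable _ _ _ _ _ _
  (fun v : void + option ('I_1 * 'I_4) -> nat =>
     matv (fun i => v (inr (Some (ord0, i)))) = Mat 1 0 (v (inr None)) 1)).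
  by rewrite /matv; definability.
move=> v; rewrite -(code_nseq _ i00) -eq_entry; split=> [H j i|H].
  by rewrite ord1; move: (congr1 (@^~ i) H).
by apply: funext => i; apply: H.
Qed.

End ArithmeticInMonoid.

Lemma free_monoid_iso (X Y : Type) (e : X -> Y) :
  bijective e -> isomorphism (free_monoid X) (free_monoid Y) (map e).
Proof.
move=> [g eK gK]; split; first by exists (map g); apply: mapK.
- by case=> x //=; rewrite map_cat.
- by case.
Qed.

Theorem corollary2 (n : nat) (hn : 1 < n) :
  exists (I : interpretation monoid_language arith_language void)
         (J : interpretation arith_language monoid_language 'I_n)
         (F : formula monoid_language ('I_n + option ('I_(dim I) * 'I_(dim J))))
         (G : formula arith_language (void + option ('I_(dim J) * 'I_(dim I)))),
    forall (X : finType) (e : 'I_n -> X), bijective e ->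
      biinterpretation F G
        (free_monoid X) (fun i => [:: e i])
        standard_arithmetic (of_void nat).
Proof.
have n_gt0 := ltnW hn.
(* The first two letters serve as x_0 and x_1; index 0 is what [definable_unary_graph] asks of
   [i0]. *)
pose i0 := Ordinal n_gt0; pose i1 := Ordinal hn.
have neq01 : i0 != i1 by [].
have [domI [eqvI [opsI [predsI cI]]]] := monoid_in_arithmetic n_gt0.
have [domJ [eqvJ [opsJ [predsJ cJ]]]] := arithmetic_in_monoid neq01.
have [F FE] := definable_code_graph neq01.
have [G GE] := @definable_unary_graph n i0 erefl.
exists (Interpretation domI eqvI opsI predsI).
exists (Interpretation domJ eqvJ opsJ predsJ), F, G.
(* All formulas are fixed before [X] and [e] appear, which is uniformity; only the codings are
   transported along [map e]. *)
move=> X e bij_e.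
have iso := free_monoid_iso bij_e; have [[g hK gK] _ _] := iso.
have cI' := codes_iso_source cI (isomorphism_inv iso hK gK).
have cJ' := codes_iso_target cJ iso.
apply: (codes_biinterpretation cI' cJ').
- apply: (defines_iso iso FE) => v /=; rewrite hK.
  by split=> H i j; [apply: (can_inj hK)|rewrite -H].
(* Number codes acquire [map e] and word codes its inverse; these cancel in this composite. *)
- by move=> v; rewrite GE /= ; split=> H j i; move: (H j i); rewrite hK.
Qed.
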